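(* For each positive integer $m$, there is a matroid $M$ such that the sequence $(W_0, W_1, \dotsc, W_r)$ of Whitney numbers of the second kind of $M$, where $r$ is the rank of $M$, has exactly $m$ peaks.
   Context: Matroids are on finite ground sets. For a matroid $M$ of rank $r$ and an integer $0 \le i \le r$, the Whitney number of the second kind $W_i = W_i(M)$ is the number of flats of $M$ of rank $i$. In a sequence $(a_0, a_1, \dotsc, a_s)$ of real numbers, a \emph{peak} is an index $i \in \{0, \dotsc, s\}$ such that $a_i > a_{i-1}$ and $a_i = a_{i+1} = \dotsb = a_{i+t} > a_{i+t+1}$ for some nonnegative integer $t$, where $a_{-1}$ and $a_{s+1}$ are interpreted as $-\infty$. *)

(* Defs.v *)
From mathcomp Require Import all_boot all_order.

Set Implicit Arguments.
Unset Strict Implicit.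
Unset Printing Implicit Defensive.

(* The ground set is the whole finite type [T], which may be empty. *)
Record matroid (T : finType) := Matroid {
  indep : pred {set T};
  indep_set0 : indep set0;
  indep_subset : forall I J : {set T}, J \subset I -> indep I -> indep J;
  indep_augment : forall I J : {set T}, indep I -> indep J -> #|I| < #|J| ->
    exists2 x, x \in J :\: I & indep (x |: I)
}.

Section Flats.
Variables (T : finType) (M : matroid T).

Definition rank_of (A : {set T}) : nat :=
  \max_(I : {set T} | (I \subset A) && indep M I) #|I|.

Definition rank : nat := rank_of [set: T].

Definition flat (F : {set T}) : bool :=
  [forall x, (x \notin F) ==> (rank_of F < rank_of (x |: F))].

Definition whitney2 (i : nat) : nat :=
  #|[set F : {set T} | flat F && (rank_of F == i)]|.

End Flats.

Section Peaks.
Import Order.Theory.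
Variables (d : Order.disp_t) (R : orderType d).

(* The sequence is (a 0, ..., a s): values of [a] beyond [s] are ignored.  The
   disjuncts [i == 0] and [i + t == s] encode the convention that the terms of
   index -1 and s + 1 are -oo, so that comparison with them is always strict. *)
Definition peak (a : nat -> R) (s : nat) (i : 'I_s.+1) : bool :=
  ((i == 0 :> nat) || (a i.-1 < a i)%O) &&
  [exists t : 'I_s.+1,
    [&& i + t <= s,
        [forall j : 'I_t.+1, a (i + j) == a i]
      & (i + t == s) || (a (i + t).+1 < a (i + t))%O]].

Definition num_peaks (a : nat -> R) (s : nat) : nat :=
  #|[set i : 'I_s.+1 | peak a i]|.

End Peaks.

(* Main.v *)
Require Import Defs.
From mathcomp Require Import all_boot all_order all_algebra.
From mathcomp Require Import zify.

(* Let Delta be a simplicial complex on P, and let the sets [c i], i in I, be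
   nonfaces of Delta containing all the minimal ones.  Give P independent
   vectors [d_p], and for each i take q vectors [d_i + a u_i], a < q, on the
   line through a new vector [d_i] and [u_i], the sum of [d_p] over p in [c i].
   A flat contains none, one or all of the q points of line i.  A choice of one
   point on every line together with J is closed exactly when no [u_i] lies in
   the span of J, that is when J is a face.  With s = #|I| and f_j the number of
   faces of size j, this gives W_(s+j) = f_j q^s + O(q^(s-1)), while W_k has
   order q^k for k <= s.  So for q large the Whitney numbers rise up to rank s
   and then follow the face numbers of Delta; truncating removes the later
   ranks.

   Any face numbers will do.  If J is a face when it is contained in the first
   t_(#|J|/2) points, with t nonincreasing, then f_j = C(t_(j/2), j), and a
   tower t_i = 2^t_(i+1) makes f rise from 2i to 2i+1 and drop from 2i+1 to
   2i+2. *)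

Set Implicit Arguments.
Unset Strict Implicit.
Unset Printing Implicit Defensive.

(** Adding a point to a flat of full rank would have to raise its rank, so only the whole ground set
    qualifies. This value makes the last step of the sequence a descent. *)
Lemma whitney2_rank (T : finType) (M : matroid T) : whitney2 M (rank M) = 1.
Proof.
rewrite /whitney2 (_ : [set F | _] = [set setT]) ?cards1 //.
apply/setP=> F; rewrite !inE; apply/andP/eqP => [[flatF /eqP rkF] | ->].
  apply/eqP; rewrite -subTset; apply/subsetP=> x _; apply: contraT => xF.
  have := forallP flatF x; rewrite xF rkF ltnNge => /negP[].
  apply/bigmax_leqP => A /andP[_ indA].
  by apply: (@leq_bigmax_cond _ _ (fun A : {set T} => #|A|)); rewrite subsetT.
by split; [apply/forallP=> x; rewrite inE | rewrite /rank].
Qed.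

(** * Truncated linear matroids and their flats *)

Section VectorMatroid.
Variables (F : fieldType) (vT : vectType F) (T : finType) (v : T -> vT).

Definition vspan (A : {set T}) : {vspace vT} := (\sum_(x in A) <[v x]>)%VS.

Lemma mem_vspan (A : {set T}) x : x \in A -> v x \in vspan A.
Proof. by move=> xA; rewrite memvE; apply: (sumv_sup x). Qed.

Lemma vspan_sub (A : {set T}) (U : {vspace vT}) :
  (forall x, x \in A -> v x \in U) -> (vspan A <= U)%VS.
Proof. by move=> AU; apply/subv_sumP=> x /AU; rewrite memvE. Qed.

Lemma vspanS (A B : {set T}) : A \subset B -> (vspan A <= vspan B)%VS.
Proof. by move=> /subsetP sAB; apply: vspan_sub => x /sAB/mem_vspan. Qed.

Lemma vspanU1 x A : (vspan (x |: A) = <[v x]> + vspan A)%VS.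
Proof.
apply/eqP; rewrite eqEsubv; apply/andP; split.
  apply: vspan_sub => y /setU1P[-> | yA].
    by rewrite (subvP (addvSl _ _)) ?memv_line.
  by rewrite (subvP (addvSr _ _)) ?mem_vspan.
by rewrite subv_add -memvE mem_vspan ?setU11 // vspanS ?subsetUr.
Qed.

Lemma dim_vspanU1 x A : v x \notin vspan A ->
  \dim (vspan (x |: A)) = (\dim (vspan A)).+1.
Proof.
move=> xA; rewrite vspanU1 dimv_disjoint_sum ?dim_vline.
  by case: eqVneq xA => [-> | _ _]; rewrite ?mem0v ?add1n.
apply/eqP; rewrite -subv0; apply/subvP=> w; rewrite memv_cap => /andP[].
case/vlineP=> k ->; rewrite memv0; have [-> | k0] := eqVneq k 0%R.
  by rewrite GRing.scale0r.
by move/(memvZ k^-1%R); rewrite GRing.scalerA GRing.mulVf // GRing.scale1r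
  (negPf xA).
Qed.

Lemma dim_vspan_le A : \dim (vspan A) <= #|A|.
Proof.
apply: leq_trans (dimv_leq_sum _ _ _) _; rewrite -sum1_card.
by apply: leq_sum => x _; rewrite dim_vline leq_b1.
Qed.

(** Induction on the cardinality: removing one vector lowers the dimension by one, and the
    hypothesis passes to subsets. *)
Lemma dim_vspan_free (A : {set T}) :
  (forall x, x \in A -> v x \notin vspan (A :\ x)) -> \dim (vspan A) = #|A|.
Proof.
have [n] := ubnP #|A|; elim: n A => // n IHn A leA freeA.
have [-> | [x xA]] := set_0Vmem A.
  by rewrite /vspan big_set0 dimv0 cards0.
rewrite -{1}(setD1K xA) dim_vspanU1 ?freeA // (cardsD1 x) xA IHn //.
  by rewrite (cardsD1 x) xA in leA.
move=> y /setD1P[_ yA]; apply: contra (freeA y yA).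
by apply/subvP/vspanS/setSD/subsetDl.
Qed.

Lemma vspan_extend (A B : {set T}) : \dim (vspan A) < \dim (vspan B) ->
  exists2 x, x \in B & v x \notin vspan A.
Proof.
move=> ltAB; apply/exists_inP; apply: contraTT ltAB.
rewrite negb_exists -leqNgt => /forallP subBA; apply/dimvS/vspan_sub => x xB.
by have := subBA x; rewrite xB negbK.
Qed.

Variable r : nat.

(** Linear independence of the family [v] on [A]; the bound by [r] truncates the linear matroid. *)
Definition vindep (A : {set T}) := (\dim (vspan A) == #|A|) && (#|A| <= r).

Lemma vindep0 : vindep set0.
Proof. by rewrite /vindep /vspan big_set0 dimv0 cards0 eqxx. Qed.

(** Subadditivity of dimension gives |A| = dim A <= dim B + |A \ B|, hence |B| <= dim B. *)
Lemma vindepS (A B : {set T}) : B \subset A -> vindep A -> vindep B.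
Proof.
move=> sBA /andP[/eqP dimA leA].
rewrite /vindep (leq_trans (subset_leq_card sBA)) // andbT eqn_leq dim_vspan_le.
have /dimvS : (vspan A <= vspan B + vspan (A :\: B))%VS.
  apply: vspan_sub => x xA; have [xB | xB] := boolP (x \in B).
    by rewrite (subvP (addvSl _ _)) ?mem_vspan.
  by rewrite (subvP (addvSr _ _)) ?mem_vspan // inE xB.
move/leq_trans/(_ (dimv_add_leqif _ _)); rewrite dimA -(cardsID B A).
rewrite (setIidPr sBA) => /leq_trans/(_ (leq_add (leqnn _) (dim_vspan_le _))).
by rewrite leq_add2r.
Qed.

Lemma vindep_augment (A B : {set T}) : vindep A -> vindep B -> #|A| < #|B| ->
  exists2 x, x \in B :\: A & vindep (x |: A).
Proof.
move=> /andP[/eqP dimA _] /andP[/eqP dimB leB] ltAB.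
have [|x xB xA] := @vspan_extend A B; first by rewrite dimA dimB.
have xnA : x \notin A by apply: contra xA; apply: mem_vspan.
exists x; first by rewrite inE xnA.
rewrite /vindep dim_vspanU1 // dimA cardsU1 xnA add1n eqxx /=.
exact: leq_trans leB.
Qed.

Definition vmatroid : matroid T := Matroid vindep0 vindepS vindep_augment.

Lemma vspan_basis (A : {set T}) k : k <= \dim (vspan A) ->
  exists I : {set T}, [/\ I \subset A, #|I| = k & \dim (vspan I) = k].
Proof.
elim: k => [|k IHk] lekA.
  by exists set0; rewrite sub0set cards0 /vspan big_set0 dimv0.
have [I [sIA cardI dimI]] := IHk (ltnW lekA).
have [|x xA xI] := @vspan_extend I A; first by rewrite dimI.
have xnI : x \notin I by apply: contra xI; apply: mem_vspan.
exists (x |: I); rewrite subUset sub1set xA sIA cardsU1 xnI cardI.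
by rewrite dim_vspanU1 ?dimI.
Qed.

Lemma rank_of_vmatroid (A : {set T}) :
  rank_of vmatroid A = minn r (\dim (vspan A)).
Proof.
apply/eqP; rewrite eqn_leq; apply/andP; split.
  apply/bigmax_leqP => I /andP[sIA /andP[/eqP <- leI]].
  by rewrite leq_min leI dimvS ?vspanS.
have [I [sIA cardI dimI]] := vspan_basis (geq_minr r (\dim (vspan A))).
rewrite -[X in X <= _]cardI.
apply: (@leq_bigmax_cond _ _ (fun I : {set T} => #|I|)).
by rewrite sIA /= /vindep cardI dimI eqxx geq_minl.
Qed.

Definition vclosed (A : {set T}) := [forall x, (v x \in vspan A) ==> (x \in A)].

(** Truncation changes no flat of rank below [r]: when dim A < r, a vector outside the span of A
    still raises the truncated rank. *)
Lemma whitney2_vmatroid k : k < r ->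
  whitney2 vmatroid k = #|[set A | vclosed A && (\dim (vspan A) == k)]|.
Proof.
move=> ltkr; apply: eq_card => A; rewrite !inE.
rewrite rank_of_vmatroid; have -> : (minn r (\dim (vspan A)) == k) =
  (\dim (vspan A) == k) by lia.
case: eqP => [dimA | _]; last by rewrite !andbF.
rewrite !andbT; apply: eq_forallb => x; rewrite !rank_of_vmatroid dimA.
have [xA | xA] := boolP (x \in A); first by rewrite implybT.
have [xsp | /dim_vspanU1->] := boolP (v x \in vspan A); last first.
  by rewrite /= dimA; lia.
rewrite /= ltnNge leq_min geq_minl /=; apply/negbTE; rewrite negbK.
apply: leq_trans (geq_minr _ _) _; rewrite -dimA dimvS // vspanU1.
by rewrite subv_add -memvE xsp subvv.
Qed.

End VectorMatroid.

Lemma card_set_of (T : finType) : #|{set T}| = 2 ^ #|T|.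
Proof. by rewrite -(cardsT {set T}) -powersetT card_powerset cardsT. Qed.

(** * The vector configuration of a family of subsets *)

Section Configuration.
Import GRing.Theory Num.Theory.
Variables (P I : finType) (c : I -> {set P}) (q' : nat).
(* The count of closed sets needs two distinct points on each line. *)
Let q := q'.+2.
Let E : finType := (P + I * 'I_q)%type.
Let V : vectType rat := {ffun P + I -> rat^o}.
Local Open Scope ring_scope.

(** The points d_p and d_i are the unit vectors, and u_i is the indicator vector of [c i]. Over
    [rat] the scalars [a] < [q] are pairwise distinct, however large [q] is. *)
Definition config_vec (x : E) : V := [ffun y => match x, y with
  | inl p, inl p' => (p == p')%:R
  | inl _, inr _ => 0
  | inr (i, a), inl p => (a * (p \in c i))%:R
  | inr (i, _), inr j => (i == j)%:R
  end].

Lemma sum_vecE (K : finType) (D : pred K) (u : K -> V) y :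
  (\sum_(k | D k) u k) y = \sum_(k | D k) u k y.
Proof. exact: sum_ffunE. Qed.

Notation sp := (vspan config_vec).
Notation clsd := (vclosed config_vec).

(** * Closed sets described line by line, and their number *)

Definition row_at (A : {set E}) i := [set a | inr (i, a) \in A].

Lemma config_vec_line (A : {set E}) i a b b' : a != b ->
  inr (i, a) \in A -> inr (i, b) \in A -> config_vec (inr (i, b')) \in sp A.
Proof.
move=> nab /(mem_vspan config_vec) Aa /(mem_vspan config_vec) Ab.
(* The affine coordinate of the third point with respect to the two given ones. *)
pose k : rat := (b'%:R - a%:R) / (b%:R - a%:R).
suff -> : config_vec (inr (i, b')) =
    config_vec (inr (i, a)) +
      k *: (config_vec (inr (i, b)) - config_vec (inr (i, a))).
  by rewrite memvD ?memvZ ?memvB.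
have nz : b%:R - a%:R != 0 :> rat.
  by rewrite subr_eq0 eqr_nat eq_sym; apply: contra nab => /eqP/val_inj->.
apply/ffunP=> -[p | j]; rewrite !ffunE; last by rewrite subrr scaler0 addr0.
by rewrite !natrM -mulrBl [_ *: _]mulrA divfK // -mulrDl addrC subrK.
Qed.

Lemma row_atP A i : clsd A ->
  [\/ row_at A i = set0, exists a, row_at A i = [set a] | row_at A i = setT].
Proof.
move=> /forallP clA; have [-> | [a Aa]] := set_0Vmem (row_at A i).
  exact: Or31.
have [sub | /subsetPn[b Ab nba]] := boolP (row_at A i \subset [set a]).
  by apply: Or32; exists a; apply/eqP; rewrite eqEsubset sub sub1set.
apply: Or33; apply/setP=> b'; rewrite !inE in Aa Ab nba *.
by apply: (implyP (clA _)); apply: config_vec_line Aa Ab; rewrite eq_sym.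
Qed.

(** [None] stands for both an empty and a full line; the set of full lines must therefore be
    recorded separately to recover a closed set. *)
Definition single_at (A : {set E}) : {ffun I -> option 'I_q} :=
  [ffun i => [pick a | row_at A i == [set a]]].
Definition singles (A : {set E}) := [set i | single_at A i != None].
Definition points (A : {set E}) := [set p | inl p \in A].

Lemma single_atP A i a : single_at A i = Some a <-> row_at A i = [set a].
Proof.
rewrite ffunE; case: pickP => [b /eqP -> | no].
  by split=> [[->] // | ab]; congr Some; apply/set1P; rewrite -ab set11.
by split=> // e; have := no a; rewrite e eqxx.
Qed.

Lemma clsd_inj A B : clsd A -> clsd B -> points A = points B ->
  [set i | row_at A i == setT] = [set i | row_at B i == setT] ->
  single_at A = single_at B -> A = B.
Proof.
move=> clA clB eqJ eqT eqS.
have eqrow i : row_at A i = row_at B i.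
  have eqSi : single_at A i = single_at B i by rewrite eqS.
  have eqTi : (row_at A i == setT) = (row_at B i == setT).
    by have := congr1 (fun D : {set I} => i \in D) eqT; rewrite !inE.
  have [eA | [a eA] | eA] := row_atP i clA; last first.
  - by move: eqTi; rewrite eA eqxx => /esym/eqP->.
  - by move/single_atP: (eA); rewrite eqSi eA => /single_atP.
  have [eB | [a eB] | eB] := row_atP i clB; first by rewrite eA.
    by move/single_atP: (eB); rewrite -eqSi => /single_atP ->.
  by move: eqTi; rewrite eB eqxx => /eqP.
apply/setP=> -[p | [i a]].
  by have := congr1 (fun D : {set P} => p \in D) eqJ; rewrite !inE.
by have := congr1 (fun D : {set 'I_q} => a \in D) (eqrow i); rewrite !inE.
Qed.

(** There are at most 2^|I| supports, and a support of size at most t carries at most q^t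
    functions. *)
Lemma card_opt_ffun t :
  (#|[set h : {ffun I -> option 'I_q} | #|[set i | h i != None]| <= t]|
     <= 2 ^ #|I| * q ^ t)%N.
Proof.
pose supp (h : {ffun I -> option 'I_q}) := [set i | h i != None].
rewrite -sum1dep_card (partition_big supp (fun D => #|D| <= t)%N) //=.
have -> : (2 ^ #|I| * q ^ t = \sum_(D : {set I}) q ^ t)%N.
  by rewrite sum_nat_const card_set_of.
rewrite [leqRHS](bigID (fun D : {set I} => #|D| <= t)%N) /=.
apply: leq_trans (leq_addr _ _); apply: leq_sum => D leD.
rewrite sum1dep_card; apply: leq_trans (_ : q ^ #|D| <= _)%N; last first.
  by rewrite leq_exp2l.
have <- : #|pffun_on (None : option 'I_q) D [pred x | x != None]| =
    (q ^ #|D|)%N.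
  rewrite card_pffun_on; congr (_ ^ _)%N.
  rewrite (eq_card (B := predC1 (None : option 'I_q))) // cardC1.
  by rewrite card_option card_ord.
apply/subset_leq_card/subsetP=> h; rewrite !inE => /andP[_ /eqP <-].
apply/pffun_onP; split=> [|_ /imageP[i + ->]]; last by rewrite !inE.
by apply/subsetP=> i; rewrite !inE.
Qed.

(** A closed set is encoded by its points in [P], its full lines and its single points. The factors
    bound the choices of the first two, then of the support and the values of the third. *)
Lemma card_clsd_singles t :
  (#|[set A | clsd A && (#|singles A| <= t)]|
     <= 2 ^ #|P| * 2 ^ #|I| * 2 ^ #|I| * q ^ t)%N.
Proof.
pose code (A : {set E}) :=
  (points A, ([set i | row_at A i == setT], single_at A)).
rewrite -(@card_in_imset _ _ code); last first.
  move=> A B; rewrite !inE => /andP[clA _] /andP[clB _] [].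
  exact: clsd_inj.
rewrite -!mulnA.
pose R := [set h : {ffun I -> option 'I_q} | (#|[set i | h i != None]| <= t)%N].
apply: (@leq_trans #|setX [set: {set P}] (setX [set: {set I}] R)|).
  apply/subset_leq_card/subsetP=> _ /imsetP[A + ->].
  by rewrite !inE => /andP[_].
by rewrite !cardsX !cardsT !card_set_of !leq_mul // card_opt_ffun.
Qed.

(** * Selections: some points of [P] and one point on each of some lines *)

Definition selection (J : {set P}) (D : {set I}) (g : I -> 'I_q) : {set E} :=
  [set x | match x with
           | inl p => p \in J
           | inr (i, a) => (i \in D) && (a == g i)
           end].

(** These linear equations hold for every generator: the selected point of line i has coordinate 1
    at i and [g i] at each p in [c i], while the d_p with p in J vanish at the coordinates of [P]
    outside J. *)
Lemma selection_vspan J D g w : w \in sp (selection J D g) ->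
  (forall p, p \notin J ->
     w (inl p) = \sum_i (g i * (p \in c i))%:R * w (inr i))
  /\ (forall i, i \notin D -> w (inr i) = 0).
Proof.
case/memv_sumP=> u u_in ->; split=> [p pJ | i iD].
  under [RHS]eq_bigr => i _ do rewrite sum_vecE mulr_sumr.
  rewrite sum_vecE exchange_big; apply: eq_bigr => x xs.
  have /vlineP[k ->] := u_in x xs; move: xs; rewrite inE.
  case: x => [p' p'J | [i a] /andP[iD /eqP->]].
    rewrite big1 => [|i _]; rewrite !ffunE ?scaler0 ?mulr0 //.
    by case: eqP p'J pJ => [-> -> // | _ _ _]; rewrite scaler0.
  rewrite (bigD1 i) //= big1 ?addr0 => [|j ji]; rewrite !ffunE.
    by rewrite eqxx [k *: 1%:R]mulr1 [RHS]mulrC.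
  by rewrite eq_sym (negPf ji) scaler0 mulr0.
rewrite sum_vecE big1 // => x xs; have /vlineP[k ->] := u_in x xs.
move: xs; rewrite inE; case: x => [p' _ | [j a] /andP[jD _]]; rewrite !ffunE.
  by rewrite scaler0.
by case: eqP jD iD => [-> -> // | _ _ _]; rewrite scaler0.
Qed.

Definition avoids (J : {set P}) (D : {set I}) :=
  [forall i in D, ~~ (c i \subset J)].

(** If a point [a] of a line i in D lies in the span, the equation at a coordinate p in [c i]
    outside J reads a = g i. This is where [avoids] enters. *)
Lemma selection_closed J D g : avoids J D -> clsd (selection J D g).
Proof.
move=> /forall_inP avJ; apply/forallP=> -[p | [i a]];
  apply/implyP=> /selection_vspan[uJ uD].
  rewrite inE; apply: contraT => pJ; have := uJ p pJ.
  rewrite ffunE eqxx big1 => [|i _]; last by rewrite ffunE mulr0.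
  by move/eqP; rewrite oner_eq0.
rewrite inE; have [iD | /uD] := boolP (i \in D); last first.
  by rewrite ffunE eqxx => /eqP; rewrite oner_eq0.
have /subsetPn[p pc pJ] := avJ i iD; have := uJ p pJ.
rewrite ffunE pc (bigD1 i) //= big1 => [|j ji]; last first.
  by rewrite ffunE eq_sym (negPf ji) mulr0.
rewrite pc ffunE eqxx mulr1 addr0 !muln1 => /eqP; rewrite eqr_nat.
by move/eqP/val_inj->.
Qed.

Lemma dim_selection J D g : \dim (sp (selection J D g)) = (#|J| + #|D|)%N.
Proof.
rewrite dim_vspan_free; last first.
  case=> [p | [i a]]; rewrite inE.
    (* Removing a point leaves a smaller selection, whose equations the removed vector violates:
       they would say 1 = 0. *)
    move=> pJ; suff -> : selection J D g :\ inl p = selection (J :\ p) D g.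
      apply: contraL isT => /selection_vspan[/(_ p)].
      rewrite setD11 => /(_ isT).
      rewrite ffunE eqxx big1 => [|i _]; last by rewrite ffunE mulr0.
      by move/eqP; rewrite oner_eq0.
    by apply/setP=> -[p' | [i a]]; rewrite !inE.
  move=> /andP[iD /eqP->].
  suff -> : selection J D g :\ inr (i, g i) = selection J (D :\ i) g.
    apply: contraL isT => /selection_vspan[_ /(_ i)].
    rewrite setD11 => /(_ isT).
    by rewrite ffunE eqxx => /eqP; rewrite oner_eq0.
  apply/setP=> -[p' | [j b]]; rewrite !inE //=.
  have [-> | ji] := eqVneq j i.
    by case: (eqVneq b (g i)) => [-> | _]; rewrite ?eqxx ?andbF.
  by have -> : inr (j, b) != inr (i, g i) :> E by apply: contra ji => /eqP[->].
have -> : selection J D g =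
    [set inl p | p in J] :|: [set inr (i, g i) | i in D].
  apply/setP=> -[p | [i a]]; rewrite !inE.
    rewrite mem_imset => [|x y []//]; case: (p \in J) => //=.
    by apply/esym/imsetP=> -[].
  apply/idP/orP=> [/andP[iD /eqP->] | [/imsetP[]// | /imsetP[j jD [-> ->]]]].
    by right; apply/imsetP; exists i.
  by rewrite jD eqxx.
rewrite cardsU disjoint_setI0 ?cards0 ?subn0; last first.
  by apply/pred0P=> x /=; apply/negbTE/andP=> -[/imsetP[p _ ->] /imsetP[]].
by rewrite !card_imset // => [i j []|p p' []].
Qed.

Local Open Scope nat_scope.

(** The functions are [ord0] outside D, so that each selection comes from exactly one function. *)
Definition selections j D :=
  [set selection x.1 D x.2 | x : {set P} * {ffun I -> 'I_q} in
  setX [set J : {set P} | (#|J| == j) && avoids J D]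
       [set g in pffun_on (ord0 : 'I_q) D predT]].

Lemma card_selections j D :
  #|selections j D| =
    #|[set J : {set P} | (#|J| == j) && avoids J D]| * q ^ #|D|.
Proof.
rewrite card_in_imset; last first.
  move=> [J g] [J' g'] /setXP[/= _]; rewrite inE => /pffun_onP[gD _].
  case/setXP=> /= _; rewrite inE => /pffun_onP[gD' _] /setP eqs.
  congr (_, _); first by apply/setP=> p; have := eqs (inl p); rewrite !inE.
  apply/ffunP=> i; have [iD | iD] := boolP (i \in D).
    by have := eqs (inr (i, g i)); rewrite !inE iD eqxx => /esym/eqP.
  have out (h : {ffun I -> 'I_q}) : ord0.-support h \subset D -> h i = ord0.
    by move/subsetP=> hD; apply/eqP; apply: contraNT iD => hi; apply: hD.
  by rewrite !out.
by rewrite cardsX [X in _ * X]cardsE card_pffun_on card_ord.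
Qed.

(** * Estimates for the Whitney numbers *)

Variable r : nat.
Let W := whitney2 (vmatroid config_vec r).
Let K := 2 ^ #|P| * 2 ^ #|I| * 2 ^ #|I|.
Let f (j : nat) := #|[set J : {set P} | (#|J| == j) && avoids J setT]|.

Lemma whitney2_ge j (D : {set I}) : j + #|D| < r ->
  #|[set J : {set P} | (#|J| == j) && avoids J D]| * q ^ #|D| <= W (j + #|D|).
Proof.
move=> ltr; rewrite -card_selections /W whitney2_vmatroid //.
apply/subset_leq_card/subsetP=> _ /imsetP[[J g] + ->].
rewrite !inE /= => /andP[/andP[/eqP <- avJ] _].
by rewrite selection_closed // dim_selection eqxx.
Qed.

Lemma selection_sub A (g : I -> 'I_q) :
  (forall i, i \in singles A -> single_at A i = Some (g i)) ->
  selection (points A) (singles A) g \subset A.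
Proof.
move=> gA; apply/subsetP=> -[p | [i a]]; rewrite inE; first by rewrite inE.
case/andP=> /gA/single_atP gi /eqP ->.
by have := set11 (g i); rewrite -gi inE.
Qed.

Lemma single_at_odflt A i : i \in singles A ->
  single_at A i = Some (odflt ord0 (single_at A i)).
Proof. by rewrite inE; case: (single_at A i). Qed.

(** [A] contains a selection using all its single points, whose dimension is at least their
    number. *)
Lemma card_singles_le A : #|singles A| <= \dim (sp A).
Proof.
have := dimvS (vspanS config_vec (selection_sub (@single_at_odflt A))).
by rewrite dim_selection; apply: leq_trans; apply: leq_addl.
Qed.

Lemma whitney2_le k : k < r -> W k <= K * q ^ k.
Proof.
move=> ltkr; rewrite /W whitney2_vmatroid //.
apply: leq_trans (card_clsd_singles k); apply/subset_leq_card/subsetP=> A.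
by rewrite !inE => /andP[-> /eqP <-]; apply: card_singles_le.
Qed.

(** A closed set with exactly one point on every line is a selection. If its points contained some
    [c i], its span would contain u_i and hence all of line i, against line i having one point. *)
Lemma full_selections A j : clsd A -> singles A = setT ->
  \dim (sp A) = j + #|I| -> A \in selections j setT.
Proof.
move=> clA sA dimA; pose g := [ffun i => odflt ord0 (single_at A i)].
have gA i : row_at A i = [set g i].
  apply/single_atP; rewrite [g i]ffunE.
  by apply: single_at_odflt; rewrite sA inE.
have eA : A = selection (points A) setT g.
  apply/setP=> -[p | [i a]]; rewrite !inE //=.
  by have /setP/(_ a) := gA i; rewrite !inE.
apply/imsetP; exists (points A, g); last exact: eA.
rewrite !inE /=; apply/andP; split; last first.
  by apply/pffun_onP; split=> //; apply/subsetP=> i; rewrite inE.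
move/eqP: dimA; rewrite eA dim_selection cardsT eqn_add2r -eA => -> /=.
apply/forall_inP=> i _; apply/negP=> /subsetP cA.
(* A second point of line i; it exists because q >= 2. *)
pose b : 'I_q := if g i == ord0 then ord_max else ord0.
have nb : b != g i.
  by rewrite /b; have [-> // | ] := eqVneq (g i) ord0; rewrite eq_sym.
case/negP: nb; suff: b \in row_at A i by rewrite gA inE.
rewrite inE; apply: (implyP (forallP clA _)).
have -> : config_vec (inr (i, b)) = (config_vec (inr (i, g i)) +
    \sum_(p in c i) (b%:R - (g i)%:R) *: config_vec (inl p))%R.
  apply/ffunP=> -[p | j']; rewrite ffunE [RHS]ffunE sum_vecE ffunE.
    have [pc | pc] := boolP (p \in c i).
      rewrite (bigD1 p) //= big1 ?addr0 => [|p' /andP[_ np]].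
        by rewrite !ffunE eqxx [(_ *: _)%R]mulr1 !muln1 addrC subrK.
      by rewrite !ffunE (negPf np) scaler0.
    rewrite big1 ?addr0 ?muln0 // => p' pc'.
    by rewrite !ffunE; case: eqP pc' pc => [-> -> // | _ _ _]; rewrite scaler0.
  by rewrite big1 ?addr0 // => p' _; rewrite !ffunE scaler0.
rewrite memvD ?mem_vspan //; first by have := set11 (g i); rewrite -gA inE.
by apply: memv_suml => p /cA; rewrite inE => /(mem_vspan config_vec)/memvZ->.
Qed.

(** Closed sets with a single point on every line number at most f_j q^|I|; the others have at most
    |I| - 1 single points and number at most K q^(|I| - 1). The factor [q] on the left keeps the
    exponent |I| - 1 out of the statement. *)
Lemma whitney2_top_le j : j + #|I| < r ->
  q * W (j + #|I|) <= (q * f j + K) * q ^ #|I|.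
Proof.
move=> ltr; rewrite /W whitney2_vmatroid //.
set X := [set A | _].
have : #|X| <= #|selections j setT| + #|[set A in X | #|singles A| < #|I|]|.
  apply: leq_trans (leq_card_setU _ _); apply/subset_leq_card/subsetP=> A XA.
  rewrite in_setU [X in _ || X]inE XA /= ltn_neqAle max_card andbT.
  case: eqVneq => [eI | _]; last by rewrite orbT.
  move: XA; rewrite inE => /andP[clA /eqP dimA]; rewrite full_selections //.
  by apply/eqP; rewrite eqEcard subsetT cardsT eI leqnn.
rewrite card_selections cardsT -/(f j) => /(leq_mul (leqnn q))/leq_trans; apply.
rewrite mulnDr mulnDl mulnA leq_add2l.
(* If there are no lines, no set has fewer than |I| single points, and the error term is empty. *)
have [I0 | /prednK <-] := posnP #|I|.
  by rewrite eq_card0 ?muln0 // => A; rewrite !inE I0 ltn0 andbF.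
rewrite expnS mulnCA leq_mul2l /=; apply: leq_trans (card_clsd_singles _).
apply/subset_leq_card/subsetP=> A.
by rewrite !inE => /andP[/andP[-> _]]; rewrite ltnS.
Qed.

Hypothesis ltKq : K < q.

(** W_k <= K q^k < q^(k+1) <= W_(k+1), where the last bound counts selections with J empty on k + 1
    fixed lines. *)
Lemma whitney2_incr_low k : (forall i, c i != set0) ->
  k < #|I| -> k.+1 < r -> W k < W k.+1.
Proof.
move=> c0 ltkI ltr; apply: leq_ltn_trans (whitney2_le (ltnW ltr)) _.
have [D _ cardD] : exists2 D : {set I}, D \subset setT & #|D| = k.+1.
  have : 0 < 'C(#|[set: I]|, k.+1) by rewrite bin_gt0 cardsT.
  rewrite -cards_draws => /card_gt0P[D].
  by rewrite inE => /andP[sD /eqP]; exists D.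
have := @whitney2_ge 0 D; rewrite cardD add0n => /(_ ltr); apply: leq_trans.
rewrite expnS mulnA ltn_mul2r expn_gt0 /=.
apply: (leq_trans ltKq); rewrite leq_pmull //.
apply/card_gt0P; exists set0; rewrite inE cards0 eqxx /=.
by apply/forall_inP=> i _; rewrite subset0.
Qed.

(** q W_(i+|I|) <= (q f_i + K) q^|I| < q (f_i + 1) q^|I| <= q f_j q^|I| <= q W_(j+|I|). *)
Lemma whitney2_lt_top i j : i + #|I| < r -> j + #|I| < r -> f i < f j ->
  W (i + #|I|) < W (j + #|I|).
Proof.
move=> lti ltj ltf; rewrite -(ltn_pmul2l (ltn0Sn _ : 0 < q)).
apply: leq_ltn_trans (whitney2_top_le lti) _.
have := @whitney2_ge j setT; rewrite cardsT => /(_ ltj).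
move/(leq_mul (leqnn q)); apply: leq_trans.
rewrite mulnA ltn_mul2r expn_gt0 /=.
by apply: leq_trans (leq_mul (leqnn q) ltf); rewrite mulnS addnC ltn_add2r.
Qed.

Lemma rank_configuration : r <= #|P| + #|I| -> rank (vmatroid config_vec r) = r.
Proof.
move=> le_r; rewrite /rank rank_of_vmatroid; apply/minn_idPl.
apply: leq_trans le_r _.
rewrite -!cardsT -(dim_selection setT setT (fun=> ord0)).
by rewrite dimvS ?vspanS ?subsetT.
Qed.

End Configuration.

(** * Peaks of sequences without plateaus *)

Lemma peak_distinct (a : nat -> nat) r (i : 'I_r.+1) :
  (forall k, k < r -> a k != a k.+1) ->
  peak a i = ((i == 0 :> nat) || (a i.-1 < a i)) &&
             ((i == r :> nat) || (a i.+1 < a i)).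
Proof.
move=> neq_a; rewrite /peak Order.NatOrder.ltEnat /=; congr (_ && _).
apply/existsP/idP=> [[t /and3P[le_r /forallP eq_a]] | last_i].
  (* A plateau with t > 0 would make two consecutive terms equal. *)
  have [t0 | t0] := posnP t; first by rewrite t0 addn0.
  have := neq_a i; rewrite -addn1; have lt1 : 1 < t.+1 by [].
  by have /eqP -> := eq_a (Ordinal lt1); rewrite eqxx; lia.
exists ord0; rewrite addn0 last_i andbT -ltnS ltn_ord /=.
by apply/forallP=> -[[|//] ltj]; rewrite addn0.
Qed.

Lemma num_peaks_zigzag (a : nat -> nat) s m : 0 < m ->
  (forall k, k < s -> a k < a k.+1) ->
  (forall i, i < m -> a (s + i.*2) < a (s + i.*2).+1) ->
  (forall i, i < m -> a (s + i.*2).+2 < a (s + i.*2).+1) ->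
  num_peaks a (s + m.*2) = m.
Proof.
move=> m0 low up down; set r := s + m.*2.
have step k : k < r ->
    if (k < s) || ~~ odd (k - s) then a k < a k.+1 else a k.+1 < a k.
  move=> ltkr; case: ltnP => [/low // | lesk] /=.
  have ek : k = s + ((k - s)./2).*2 + odd (k - s) by lia.
  have lt_m : (k - s)./2 < m by rewrite /r in ltkr; lia.
  case: (odd (k - s)) ek => /= ek; rewrite ek ?addn0 ?addn1.
    exact: down.
  exact: up.
rewrite /num_peaks.
have -> : [set i : 'I_r.+1 | peak a i] = [set inord (s + i.*2).+1 | i : 'I_m].
  apply/setP=> i; rewrite inE peak_distinct; last first.
    by move=> k /step; case: ifP => _; lia.
  apply/idP/imsetP=> [/andP[left_i right_i] | [j _ ->]].
    have up_i : i < r -> ((i < s) || ~~ odd (i - s)) = false.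
      move=> ltir; have := step i ltir; case: ifP => // _.
      by case/orP: right_i => [/eqP | ]; lia.
    have down_i : 0 < i -> (i.-1 < s) || ~~ odd (i.-1 - s).
      move=> i0; have := step i.-1; rewrite prednK //; case: ifP => // _.
      by case/orP: left_i => [/eqP | ]; have := ltn_ord i; lia.
    (* An index before the last is followed by a descent, which gives the claim; the last index is
       preceded by one since m > 0, so it is no peak. *)
    have [lt_s odd_i] : s <= i /\ odd (i - s).
      have [ir | ] := eqVneq (i : nat) r; last by have := ltn_ord i; lia.
      by have := down_i; rewrite ir /r; lia.
    have lt_m : (i - s)./2 < m by have : i < (s + m.*2).+1 := ltn_ord i; lia.
    by exists (Ordinal lt_m) => //; apply/val_inj; rewrite /= inordK; lia.
  have ltjm := ltn_ord j; rewrite inordK; last by rewrite /r; lia.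
  by rewrite /= up ?down ?orbT.
rewrite card_imset ?card_ord // => i j /(congr1 val) /=.
have [ltim ltjm] := (ltn_ord i, ltn_ord j).
by rewrite !inordK; [move=> eij; apply/val_inj => /= | ..]; rewrite /r; lia.
Qed.

(** * A simplicial complex with zigzag face numbers *)

Section Tower.
Variable m : nat.

(** The value 4m at i = m is the least one; it keeps the sizes 2i and 2i + 1, for i < m, in the
    increasing half of the binomial coefficients. *)
Definition tower i := iter (m - i) (expn 2) (4 * m).

Lemma tower_ge i : 4 * m <= tower i.
Proof.
rewrite /tower; elim: (m - i) => //= n IHn; apply: leq_trans IHn _.
exact/ltnW/ltn_expl.
Qed.

Lemma towerS i : i < m -> tower i = 2 ^ tower i.+1.
Proof. by move=> ltim; rewrite /tower -subnSK. Qed.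

Lemma tower_anti i j : i <= j -> tower j <= tower i.
Proof.
move=> leij; rewrite /tower; have : m - j <= m - i by lia.
move/subnK <-; elim: (m - i - _) => //= n IHn; apply: leq_trans IHn _.
exact/ltnW/ltn_expl.
Qed.

(** The ratio of the two coefficients is (n - k) / (k + 1) > 1. *)
Lemma bin_incr n k : k.*2.+1 < n -> 'C(n, k) < 'C(n, k.+1).
Proof.
move=> ltkn; have C0 : 0 < 'C(n, k) by rewrite bin_gt0; lia.
have := mul_bin_left n k; nia.
Qed.

(** The coefficients increase from C(n, 1) = n up to the middle. *)
Lemma bin_ge n k : 0 < k -> k.*2 < n.+1 -> n <= 'C(n, k).
Proof.
elim: k => // -[|k] IHk _ ltkn; first by rewrite bin1.
by apply/ltnW/(leq_ltn_trans (IHk _ _))/bin_incr; lia.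
Qed.

Lemma bin_lt_exp n k : 0 < k -> 'C(n, k) < 2 ^ n.
Proof.
move=> k0; have [ltnk | lekn] := ltnP n k; first by rewrite bin_small ?expn_gt0.
(* In the expansion of (1 + 1)^n the term C(n, 0) = 1, distinct from C(n, k), makes the inequality
   strict. *)
rewrite -[2]/(1 + 1) expnDn (bigD1 (Ordinal (lekn : k < n.+1))) //=.
rewrite !exp1n !muln1.
rewrite (bigD1 ord0) /=; last by rewrite -val_eqE /=; lia.
by rewrite bin0 !exp1n; lia.
Qed.

Lemma tower_up i : i < m -> 'C(tower i, i.*2) < 'C(tower i, i.*2.+1).
Proof. by move=> ltim; apply: bin_incr; have := tower_ge i; lia. Qed.

(** With t_i for [tower i]: C(t_(i+1), 2i+2) < 2^t_(i+1) = t_i <= C(t_i, 2i+1). *)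
Lemma tower_down i : i < m -> 'C(tower i.+1, i.*2.+2) < 'C(tower i, i.*2.+1).
Proof.
move=> ltim; apply: leq_trans (bin_ge _ _) => //; last first.
  by have := tower_ge i; lia.
by rewrite (towerS ltim) bin_lt_exp.
Qed.

Definition face (J : {set 'I_(tower 0)}) :=
  J \subset [set x : 'I_(tower 0) | x < tower #|J|./2].

(** A smaller set faces a weaker constraint, because the tower is nonincreasing. *)
Lemma faceS (J J' : {set 'I_(tower 0)}) : J' \subset J -> face J -> face J'.
Proof.
move=> sJ /subsetP fJ; apply/subsetP=> x /(subsetP sJ)/fJ; rewrite !inE.
by move/leq_trans; apply; apply/tower_anti/half_leq/subset_leq_card.
Qed.

Lemma card_faces j :
  #|[set J : {set 'I_(tower 0)} | (#|J| == j) && face J]| = 'C(tower j./2, j).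
Proof.
have <- : #|[set x : 'I_(tower 0) | x < tower j./2]| = tower j./2.
  have le0 : tower j./2 <= tower 0 by apply: tower_anti.
  have inj : injective (widen_ord le0) by move=> x y /(congr1 val) /= /val_inj.
  rewrite -[RHS]card_ord -[RHS]cardsT -(card_imset _ inj).
  apply: eq_card => x; rewrite inE; apply/idP/imsetP => [ltx | [y _ ->]] //=.
  by exists (Ordinal ltx) => //; apply/val_inj.
rewrite -cards_draws; apply: eq_card => J; rewrite !inE andbC.
by case: eqP => [eJ | _]; rewrite ?andbF // /face eJ.
Qed.

Definition nonface := {S : {set 'I_(tower 0)} | ~~ face S}.

(** A nonface contains itself, and a face contains no nonface by heredity. *)
Lemma avoids_nonface J : avoids (fun S : nonface => val S) J setT = face J.
Proof.
apply/forall_inP/idP=> [avJ | fJ S _].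
  apply: contraT => nJ; have := avJ (Sub J nJ) (in_setT _).
  by rewrite SubK subxx.
by apply: contra (valP S) => /faceS; apply.
Qed.

End Tower.

(** * Choice of the parameters and the resulting matroid *)

Theorem theorem1p2 (m : nat) (hm : 0 < m) :
  exists (T : finType) (M : matroid T), num_peaks (whitney2 M) (rank M) = m.
Proof.
pose I : finType := nonface m.
pose c (S : I) : {set 'I_(tower m 0)} := val S.
pose s := #|I|; pose r := s + m.*2.
(* This is the constant K of the estimates, so that q = K + 2 exceeds K. *)
pose q' := 2 ^ #|'I_(tower m 0)| * 2 ^ s * 2 ^ s.
pose M := vmatroid (@config_vec _ _ c q') r.
exists _, M; have rankM : rank M = r.
  apply: rank_configuration; rewrite card_ord [leqRHS]addnC leq_add2l.
  by have := tower_ge m 0; lia.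
have ltq : q' < q'.+2 by [].
have card_avoid (k : nat) :
    #|[set J : {set 'I_(tower m 0)} | (#|J| == k) && avoids c J setT]| =
      'C(tower m k./2, k).
  rewrite -card_faces; apply: eq_card => J; rewrite !inE; congr (_ && _).
  exact: avoids_nonface.
have face_lt i j : i < m.*2 -> j < m.*2 ->
    'C(tower m i./2, i) < 'C(tower m j./2, j) ->
    whitney2 M (s + i) < whitney2 M (s + j).
  move=> lti ltj ltf; rewrite ![s + _]addnC.
  by apply: whitney2_lt_top; rewrite ?card_avoid // [r]addnC ltn_add2r.
rewrite rankM; apply: num_peaks_zigzag => // [k ltks | i ltim | i ltim].
- apply: whitney2_incr_low => //; last by rewrite /r -/s; lia.
  by move=> S; apply: contra (valP S) => /eqP; rewrite /c => ->; apply: sub0set.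
- rewrite -addnS; apply: face_lt; try lia.
  by rewrite /= uphalf_double half_double tower_up.
rewrite -!addnS; have [lt_m | le_m] := ltnP i.+1 m.
  apply: face_lt; try lia.
  by rewrite /= !uphalf_double half_double tower_down.
(* Here i = m - 1, and the last descent ends at the truncation rank, which the estimates do not
   reach. There the value is 1, while the preceding one is at least C(t_i, 2i+1) >= t_i >= 4m > 1,
   where t_i is [tower m i]. *)
have -> : s + i.*2.+2 = rank M by rewrite rankM /r; lia.
have := @whitney2_ge _ _ c q' r i.*2.+1 setT.
rewrite whitney2_rank card_avoid cardsT addnC -/s /= uphalf_double => lb.
apply: leq_trans (lb _); last by rewrite /r; lia.
apply: leq_trans (leq_pmulr _ _); last by rewrite expn_gt0.
by have := tower_ge m i; have := @bin_ge (tower m i) i.*2.+1; lia.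
Qed.
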